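(* Let $\mathcal{C}$ be a strict monoidal category with unit object $I$. a) Let $(A,B)$ be a pure-braided structure on $\mathcal{C}$, and define $D_{U,V}:U\otimes V\to U\otimes V$ by $D_{U,V}:=A_{U,I,V}=B_{U,I,V}$. Then $D$ is a natural isomorphism satisfying, for all objects $X,Y,Z,T$ of $\mathcal{C}$, (i) $D_{I,X}=D_{X,I}=\mathrm{id}_X$, and (ii) $(D_{X,Y}\otimes \mathrm{id}_Z\otimes \mathrm{id}_T)(\mathrm{id}_X\otimes D_{Y\otimes Z,T})(D_{X\otimes Y,Z}\otimes \mathrm{id}_T)=(\mathrm{id}_X\otimes \mathrm{id}_Y\otimes D_{Z,T})(D_{X,Y\otimes Z}\otimes \mathrm{id}_T)(\mathrm{id}_X\otimes D_{Y,Z\otimes T})$. b) If $D_{U,V}:U\otimes V\to U\otimes V$ is a natural isomorphism satisfying (i) and (ii) for all objects $X,Y,Z,T$, then $D$ is a twine on $\mathcal{C}$, i.e. $(\mathcal{C},D)$ is an entwined category. c) If $(\mathcal{C},D)$ is an entwined category and we define $A_{X,Y,Z},B_{X,Y,Z}:X\otimes Y\otimes Z\to X\otimes Y\otimes Z$ by $$A_{X,Y,Z}=D_{X\otimes Y,Z}(\mathrm{id}_X\otimes D_{Y,Z}^{-1})=(D_{X,Y}^{-1}\otimes \mathrm{id}_Z)D_{X,Y\otimes Z},$$ $$B_{X,Y,Z}=(\mathrm{id}_X\otimes D_{Y,Z}^{-1})D_{X\otimes Y,Z}=D_{X,Y\otimes Z}(D_{X,Y}^{-1}\otimes \mathrm{id}_Z),$$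 then $(A,B)$ is a pure-braided structure on $\mathcal{C}$, i.e. $(\mathcal{C},A,B)$ is a pure-braided category.
   Context: All monoidal categories are strict, with unit object $I$; juxtaposition of morphisms denotes composition. ''Natural'' means natural in all object variables. A pure-braided structure on $\mathcal{C}$ consists of two families of natural isomorphisms $A_{U,V,W},B_{U,V,W}:U\otimes V\otimes W\to U\otimes V\otimes W$ such that for all objects $U,V,W,X$: 1. $A_{U\otimes V,W,X}=A_{U,V\otimes W,X}(\mathrm{id}_U\otimes A_{V,W,X})$; 2. $A_{U,V,W\otimes X}=(A_{U,V,W}\otimes \mathrm{id}_X)A_{U,V\otimes W,X}$; 3. $B_{U\otimes V,W,X}=(\mathrm{id}_U\otimes B_{V,W,X})B_{U,V\otimes W,X}$; 4. $B_{U,V,W\otimes X}=B_{U,V\otimes W,X}(B_{U,V,W}\otimes \mathrm{id}_X)$; 5. $(A_{U,V,W}\otimes \mathrm{id}_X)(\mathrm{id}_U\otimes B_{V,W,X})=(\mathrm{id}_U\otimes B_{V,W,X})(A_{U,V,W}\otimes \mathrm{id}_X)$; 6. $A_{U,I,V}=B_{U,I,V}$. A category with a pure-braided structure is called pure-braided. A twine on $\mathcal{C}$ is a natural isomorphism $D_{X,Y}:X\otimes Y\to X\otimes Y$ such that for all objects $X,Y,Z,T$: 1. $D_{I,I}=\mathrm{id}_I$; 2. $(D_{X,Y}\otimes \mathrm{id}_Z)D_{X\otimes Y,Z}=(\mathrm{id}_X\otimes D_{Y,Z})D_{X,Y\otimes Z}$; 3. $(D_{X\otimes Y,Z}\otimes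 \mathrm{id}_T)(\mathrm{id}_X\otimes D_{Y,Z}^{-1}\otimes \mathrm{id}_T)(\mathrm{id}_X\otimes D_{Y,Z\otimes T})=(\mathrm{id}_X\otimes D_{Y,Z\otimes T})(\mathrm{id}_X\otimes D_{Y,Z}^{-1}\otimes \mathrm{id}_T)(D_{X\otimes Y,Z}\otimes \mathrm{id}_T)$. A category with a twine is called entwined. *)

(* Defs.v *)
Declare Scope smc_scope.
Delimit Scope smc_scope with smc.
Open Scope smc_scope.

Definition hom_cast {O : Type} (H : O -> O -> Type) {X X' Y Y' : O}
    (eX : X = X') (eY : Y = Y') (f : H X Y) : H X' Y' :=
  match eX in (_ = a), eY in (_ = b) return H a b with
  | eq_refl, eq_refl => f
  end.

Record category := {
  ob :> Type;
  hom : ob -> ob -> Type;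
  idm : forall X, hom X X;
  comp : forall X Y Z, hom Y Z -> hom X Y -> hom X Z;
  comp_idl : forall X Y (f : hom X Y), comp X Y Y (idm Y) f = f;
  comp_idr : forall X Y (f : hom X Y), comp X X Y f (idm X) = f;
  comp_assoc : forall X Y Z T (h : hom Z T) (g : hom Y Z) (f : hom X Y),
    comp X Y T (comp Y Z T h g) f = comp X Z T h (comp X Y Z g f)
}.

Arguments hom {_} _ _.
Arguments idm {_} _.
Arguments comp {_ _ _ _} _ _.

Notation End X := (hom X X).
Notation "g ∘ f" := (comp g f) (at level 50, left associativity) : smc_scope.

(* Strictness on objects is an equality of objects, so the strictness laws
   for morphisms are equalities up to transport along it. *)
Record strict_monoidal_category := {
  smc_cat :> category;
  unit_ob : smc_cat;
  tens : smc_cat -> smc_cat -> smc_cat;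
  tens_hom : forall X X' Y Y' : smc_cat,
    hom X X' -> hom Y Y' -> hom (tens X Y) (tens X' Y');
  tens_id : forall X Y : smc_cat,
    tens_hom X X Y Y (idm X) (idm Y) = idm (tens X Y);
  tens_comp : forall (X X' X'' Y Y' Y'' : smc_cat)
      (g : hom X' X'') (f : hom X X') (g' : hom Y' Y'') (f' : hom Y Y'),
    tens_hom X X'' Y Y'' (g ∘ f) (g' ∘ f')
    = tens_hom X' X'' Y' Y'' g g' ∘ tens_hom X X' Y Y' f f';
  tens_assoc : forall X Y Z : smc_cat,
    tens (tens X Y) Z = tens X (tens Y Z);
  tens_unitl : forall X : smc_cat, tens unit_ob X = X;
  tens_unitr : forall X : smc_cat, tens X unit_ob = X;
  tens_hom_assoc : forall (X X' Y Y' Z Z' : smc_cat)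
      (f : hom X X') (g : hom Y Y') (h : hom Z Z'),
    hom_cast (@hom smc_cat) (tens_assoc X Y Z) (tens_assoc X' Y' Z')
      (tens_hom _ _ _ _ (tens_hom _ _ _ _ f g) h)
    = tens_hom _ _ _ _ f (tens_hom _ _ _ _ g h);
  tens_hom_unitl : forall (X X' : smc_cat) (f : hom X X'),
    hom_cast (@hom smc_cat) (tens_unitl X) (tens_unitl X')
      (tens_hom _ _ _ _ (idm unit_ob) f) = f;
  tens_hom_unitr : forall (X X' : smc_cat) (f : hom X X'),
    hom_cast (@hom smc_cat) (tens_unitr X) (tens_unitr X')
      (tens_hom _ _ _ _ f (idm unit_ob)) = f
}.

Arguments unit_ob {_}.
Arguments tens {_} _ _.
Arguments tens_hom {_ _ _ _ _} _ _.

Notation "X ⊗ Y" := (tens X Y) (at level 35, right associativity) : smc_scope.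
Notation "f ⊗ₘ g" := (tens_hom f g)
  (at level 35, right associativity) : smc_scope.

(* [same_ob X Y] is the equality [X = Y], found by rebracketing to the right
   and erasing units.  [⌊f⌋] regards an endomorphism of [X] as an endomorphism
   of [Y], as one does silently on paper.  By proof irrelevance the transport
   does not depend on the equality proof that is found. *)
Class same_ob {C : category} (X Y : C) : Prop := same_ob_eq : X = Y.
#[export] Hint Mode same_ob - ! ! : typeclass_instances.

#[export] Instance same_ob_refl (C : category) (X : C) : same_ob X X | 0.
Proof. exact eq_refl. Qed.

#[export] Instance same_ob_assoc (C : strict_monoidal_category)
    (X Y Z W : C) (e : same_ob (X ⊗ (Y ⊗ Z)) W) : same_ob ((X ⊗ Y) ⊗ Z) W | 1.
Proof. exact (eq_trans (tens_assoc C X Y Z) e). Qed.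

#[export] Instance same_ob_unitl (C : strict_monoidal_category)
    (X W : C) (e : same_ob X W) : same_ob (unit_ob ⊗ X) W | 2.
Proof. exact (eq_trans (tens_unitl C X) e). Qed.

#[export] Instance same_ob_unitr (C : strict_monoidal_category)
    (X W : C) (e : same_ob X W) : same_ob (X ⊗ unit_ob) W | 2.
Proof. exact (eq_trans (tens_unitr C X) e). Qed.

#[export] Instance same_ob_cong (C : strict_monoidal_category)
    (X Y W : C) (e : same_ob Y W) : same_ob (X ⊗ Y) (X ⊗ W) | 3.
Proof. exact (f_equal (tens X) e). Qed.

Definition end_cast {C : category} {X Y : C} {e : same_ob X Y}
    (f : End X) : End Y :=
  hom_cast (@hom C) e e f.

Notation "⌊ f ⌋" := (end_cast f) (at level 0, f at level 200) : smc_scope.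

(* Natural automorphisms of the functors [(X, Y) |-> X ⊗ Y] and
   [(X, Y, Z) |-> X ⊗ Y ⊗ Z]. *)
Record nat_auto2 (C : strict_monoidal_category) := {
  nat2 :> forall X Y : C, End (X ⊗ Y);
  inv2 : forall X Y : C, End (X ⊗ Y);
  inv2_l : forall X Y : C, inv2 X Y ∘ nat2 X Y = idm (X ⊗ Y);
  inv2_r : forall X Y : C, nat2 X Y ∘ inv2 X Y = idm (X ⊗ Y);
  nat2_natural : forall (X X' Y Y' : C) (f : hom X X') (g : hom Y Y'),
    nat2 X' Y' ∘ (f ⊗ₘ g) = (f ⊗ₘ g) ∘ nat2 X Y
}.

Arguments nat2 {_} _ _ _.
Arguments inv2 {_} _ _ _.

Record nat_auto3 (C : strict_monoidal_category) := {
  nat3 :> forall X Y Z : C, End (X ⊗ Y ⊗ Z);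
  inv3 : forall X Y Z : C, End (X ⊗ Y ⊗ Z);
  inv3_l : forall X Y Z : C, inv3 X Y Z ∘ nat3 X Y Z = idm (X ⊗ Y ⊗ Z);
  inv3_r : forall X Y Z : C, nat3 X Y Z ∘ inv3 X Y Z = idm (X ⊗ Y ⊗ Z);
  nat3_natural : forall (X X' Y Y' Z Z' : C)
      (f : hom X X') (g : hom Y Y') (h : hom Z Z'),
    nat3 X' Y' Z' ∘ (f ⊗ₘ g ⊗ₘ h) = (f ⊗ₘ g ⊗ₘ h) ∘ nat3 X Y Z
}.

Arguments nat3 {_} _ _ _ _.
Arguments inv3 {_} _ _ _ _.

Record is_pure_braided {C : strict_monoidal_category}
    (A B : nat_auto3 C) : Prop := {
  pb_A_tensl : forall U V W X : C,
    ⌊A (U ⊗ V) W X⌋ = ⌊A U (V ⊗ W) X⌋ ∘ (idm U ⊗ₘ A V W X)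
    :> End (U ⊗ V ⊗ W ⊗ X);
  pb_A_tensr : forall U V W X : C,
    A U V (W ⊗ X) = ⌊A U V W ⊗ₘ idm X⌋ ∘ ⌊A U (V ⊗ W) X⌋
    :> End (U ⊗ V ⊗ W ⊗ X);
  pb_B_tensl : forall U V W X : C,
    ⌊B (U ⊗ V) W X⌋ = (idm U ⊗ₘ B V W X) ∘ ⌊B U (V ⊗ W) X⌋
    :> End (U ⊗ V ⊗ W ⊗ X);
  pb_B_tensr : forall U V W X : C,
    B U V (W ⊗ X) = ⌊B U (V ⊗ W) X⌋ ∘ ⌊B U V W ⊗ₘ idm X⌋
    :> End (U ⊗ V ⊗ W ⊗ X);
  pb_comm : forall U V W X : C,
    ⌊A U V W ⊗ₘ idm X⌋ ∘ (idm U ⊗ₘ B V W X)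
    = (idm U ⊗ₘ B V W X) ∘ ⌊A U V W ⊗ₘ idm X⌋
    :> End (U ⊗ V ⊗ W ⊗ X);
  pb_unit : forall U V : C, A U unit_ob V = B U unit_ob V
}.

Record is_twine {C : strict_monoidal_category} (D : nat_auto2 C) : Prop := {
  tw_unit : ⌊D unit_ob unit_ob⌋ = idm unit_ob;
  tw_tens : forall X Y Z : C,
    ⌊D X Y ⊗ₘ idm Z⌋ ∘ ⌊D (X ⊗ Y) Z⌋ = (idm X ⊗ₘ D Y Z) ∘ D X (Y ⊗ Z)
    :> End (X ⊗ Y ⊗ Z);
  tw_comm : forall X Y Z T : C,
    ⌊D (X ⊗ Y) Z ⊗ₘ idm T⌋ ∘ ⌊idm X ⊗ₘ inv2 D Y Z ⊗ₘ idm T⌋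
      ∘ (idm X ⊗ₘ D Y (Z ⊗ T))
    = (idm X ⊗ₘ D Y (Z ⊗ T)) ∘ ⌊idm X ⊗ₘ inv2 D Y Z ⊗ₘ idm T⌋
      ∘ ⌊D (X ⊗ Y) Z ⊗ₘ idm T⌋
    :> End (X ⊗ Y ⊗ Z ⊗ T)
}.

Definition unital2 {C : strict_monoidal_category} (D : nat_auto2 C) : Prop :=
  forall X : C, ⌊D unit_ob X⌋ = idm X /\ ⌊D X unit_ob⌋ = idm X.

Definition four_object_identity {C : strict_monoidal_category}
    (D : nat_auto2 C) : Prop :=
  forall X Y Z T : C,
    ⌊D X Y ⊗ₘ idm Z ⊗ₘ idm T⌋ ∘ ⌊idm X ⊗ₘ D (Y ⊗ Z) T⌋
      ∘ ⌊D (X ⊗ Y) Z ⊗ₘ idm T⌋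
    = (idm X ⊗ₘ idm Y ⊗ₘ D Z T) ∘ ⌊D X (Y ⊗ Z) ⊗ₘ idm T⌋
      ∘ (idm X ⊗ₘ D Y (Z ⊗ T))
    :> End (X ⊗ Y ⊗ Z ⊗ T).

(* Main.v *)
From Stdlib Require Import Eqdep.
Require Import Defs.

(* Putting the unit object in the middle of a three-object component expresses
   A and B through D: A is D_{X⊗Y,Z} (id ⊗ D_{Y,Z}^-1) and B is the same product
   in the other order, with alternative forms obtained on the other side.  For
   such A and B, cancelling invertible factors turns both the four-object
   identity and the last twine axiom into the statement that A ⊗ id and id ⊗ B
   commute.  Strictness is handled by comparing morphisms in the type of all
   morphisms of the category, where transports disappear and the tensor product
   is strictly associative and unital. *)

(** * Morphisms compared independently of their endpoints *)

Section TotalSpaceOfMorphisms.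

Variable C : strict_monoidal_category.

Definition mor : Type := {p : C * C & hom (fst p) (snd p)}.

Definition pack {X Y : C} (f : hom X Y) : mor :=
  existT (fun p : C * C => hom (fst p) (snd p)) (X, Y) f.

Definition mtens (m n : mor) : mor := pack (projT2 m ⊗ₘ projT2 n).

(** Objects have no decidable equality, so this rests on the axiom behind [inj_pair2] of [Eqdep]
    (uniqueness of identity proofs). *)
Lemma pack_inj (X Y : C) (f g : hom X Y) : pack f = pack g -> f = g.
Proof. exact (inj_pair2 _ (fun p : C * C => hom (fst p) (snd p)) (X, Y) f g). Qed.

Lemma pack_hom_cast (X X' Y Y' : C) (eX : X = X') (eY : Y = Y') (f : hom X Y) :
  pack (hom_cast (@hom C) eX eY f) = pack f.
Proof. destruct eX, eY; reflexivity. Qed.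

Lemma pack_end_cast (X Y : C) (e : same_ob X Y) (f : End X) :
  pack (@end_cast C X Y e f) = pack f.
Proof. apply pack_hom_cast. Qed.

Lemma pack_tens (X X' Y Y' : C) (f : hom X X') (g : hom Y Y') :
  pack (f ⊗ₘ g) = mtens (pack f) (pack g).
Proof. reflexivity. Qed.

Lemma pack_idm_tens (X Y : C) :
  pack (idm (X ⊗ Y)) = mtens (pack (idm X)) (pack (idm Y)).
Proof. rewrite <- tens_id; reflexivity. Qed.

Lemma mtensA (m n p : mor) : mtens (mtens m n) p = mtens m (mtens n p).
Proof.
  destruct m as [[? ?] f], n as [[? ?] g], p as [[? ?] h].
  cbn in f, g, h; change (pack ((f ⊗ₘ g) ⊗ₘ h) = pack (f ⊗ₘ g ⊗ₘ h)).
  rewrite <- tens_hom_assoc; symmetry; apply pack_hom_cast.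
Qed.

Lemma mtens1m (m : mor) : mtens (pack (idm unit_ob)) m = m.
Proof.
  destruct m as [[? ?] f]; cbn in f.
  change (pack (idm unit_ob ⊗ₘ f) = pack f).
  pose proof (f_equal pack (tens_hom_unitl C _ _ f)) as e.
  now rewrite pack_hom_cast in e.
Qed.

Lemma mtensm1 (m : mor) : mtens m (pack (idm unit_ob)) = m.
Proof.
  destruct m as [[? ?] f]; cbn in f.
  change (pack (f ⊗ₘ idm unit_ob) = pack f).
  pose proof (f_equal pack (tens_hom_unitr C _ _ f)) as e.
  now rewrite pack_hom_cast in e.
Qed.

(** Composition is only partially defined on [mor], hence a congruence rule in place of an
    operation. Equal packages have equal endpoints; once these are identified, [pack_inj] turns the
    hypotheses into equalities of morphisms. *)
Lemma pack_comp_congr (X Y Z X' Y' Z' : C)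
    (g : hom Y Z) (f : hom X Y) (g' : hom Y' Z') (f' : hom X' Y') :
  pack g = pack g' -> pack f = pack f' -> pack (g ∘ f) = pack (g' ∘ f').
Proof.
  intros eg ef.
  pose proof (f_equal (@projT1 _ _) eg) as pg.
  pose proof (f_equal (@projT1 _ _) ef) as pf.
  cbn in pg, pf; injection pg as <- <-; injection pf as <-.
  apply pack_inj in eg, ef; subst; reflexivity.
Qed.

Lemma pack_nat2_congr (D : nat_auto2 C) (X Y X' Y' : C) :
  X = X' -> Y = Y' -> pack (D X Y) = pack (D X' Y').
Proof. intros <- <-; reflexivity. Qed.

Lemma pack_nat3_congr (A : nat_auto3 C) (X Y Z X' Y' Z' : C) :
  X = X' -> Y = Y' -> Z = Z' -> pack (A X Y Z) = pack (A X' Y' Z').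
Proof. intros <- <- <-; reflexivity. Qed.

Lemma pack_idm_congr (X X' : C) : X = X' -> pack (idm X) = pack (idm X').
Proof. intros <-; reflexivity. Qed.

End TotalSpaceOfMorphisms.

Arguments pack {C X Y} f.
Arguments mtens {C} m n.

Ltac solve_ob :=
  repeat (rewrite tens_assoc || rewrite tens_unitl || rewrite tens_unitr);
  reflexivity.

(** Strips transports, splits identities of tensor products, brackets [mtens] to the right and drops
    identities of the unit. The resulting factors are then matched one by one, and their object
    arguments are compared by [solve_ob]. *)
Ltac solve_pack :=
  repeat first
    [ rewrite pack_end_cast | rewrite pack_tens | rewrite pack_idm_tens
    | rewrite mtensA | rewrite mtens1m | rewrite mtensm1 ];
  repeat match goal with
  | |- ?x = ?x => reflexivity
  | |- mtens _ _ = mtens _ _ => apply f_equal2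
  | |- pack (_ ∘ _) = pack (_ ∘ _) => apply pack_comp_congr; solve_pack
  | |- pack (nat2 _ _ _) = _ => apply pack_nat2_congr; solve_ob
  | |- pack (nat3 _ _ _ _) = _ => apply pack_nat3_congr; solve_ob
  | |- pack (idm _) = _ => apply pack_idm_congr; solve_ob
  end.

Ltac solve_cast := apply pack_inj; solve_pack.

(** * Cancellation, transport and whiskering *)

Lemma comp_cancel_l (C : category) (X Y Z : C) (u : hom Y Z) (v : hom Z Y)
    (f g : hom X Y) : v ∘ u = idm Y -> u ∘ f = u ∘ g -> f = g.
Proof.
  intros vu e.
  now rewrite <- (comp_idl _ _ _ f), <- (comp_idl _ _ _ g), <- vu,
    !comp_assoc, e.
Qed.

Lemma comp_cancel_r (C : category) (X Y Z : C) (u : hom X Y) (v : hom Y X)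
    (f g : hom Y Z) : u ∘ v = idm Y -> f ∘ u = g ∘ u -> f = g.
Proof.
  intros uv e.
  now rewrite <- (comp_idr _ _ _ f), <- (comp_idr _ _ _ g), <- uv,
    <- !comp_assoc, e.
Qed.

(** Source of all the unit laws: specialising two objects to the unit makes a component of D
    idempotent. *)
Lemma comp_idem_id (C : category) (X : C) (f v : End X) :
  v ∘ f = idm X -> f ∘ f = f -> f = idm X.
Proof.
  intros vf ff; apply (comp_cancel_l C _ _ _ f v); [exact vf|].
  now rewrite ff, comp_idr.
Qed.

Lemma end_cast_comp (C : category) (X Y : C) (e : same_ob X Y) (f g : End X) :
  @end_cast C X Y e (f ∘ g) = end_cast f ∘ end_cast g.
Proof. destruct e; reflexivity. Qed.

Lemma end_cast_id (C : category) (X Y : C) (e : same_ob X Y) :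
  @end_cast C X Y e (idm X) = idm Y.
Proof. destruct e; reflexivity. Qed.

Lemma whisker_comp_l (C : strict_monoidal_category) (X Y Y' Y'' : C)
    (f : hom Y' Y'') (g : hom Y Y') :
  idm X ⊗ₘ (f ∘ g) = (idm X ⊗ₘ f) ∘ (idm X ⊗ₘ g).
Proof. now rewrite <- tens_comp, comp_idl. Qed.

Lemma whisker_comp_r (C : strict_monoidal_category) (X Y Y' Y'' : C)
    (f : hom Y' Y'') (g : hom Y Y') :
  (f ∘ g) ⊗ₘ idm X = (f ⊗ₘ idm X) ∘ (g ⊗ₘ idm X).
Proof. now rewrite <- tens_comp, comp_idl. Qed.

Lemma whisker_interchange (C : strict_monoidal_category) (X X' Y Y' : C)
    (f : hom X X') (g : hom Y Y') :
  (f ⊗ₘ idm Y') ∘ (idm X ⊗ₘ g) = (idm X' ⊗ₘ g) ∘ (f ⊗ₘ idm Y).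
Proof. now rewrite <- !tens_comp, !comp_idl, !comp_idr. Qed.

(** * Naturality and invertibility of D *)

Section NaturalAutomorphism.

Variable C : strict_monoidal_category.
Variable D : nat_auto2 C.

Lemma inv2_natural (X X' Y Y' : C) (f : hom X X') (g : hom Y Y') :
  inv2 D X' Y' ∘ (f ⊗ₘ g) = (f ⊗ₘ g) ∘ inv2 D X Y.
Proof.
  apply (comp_cancel_l C _ _ _ (D X' Y') (inv2 D X' Y')); [apply inv2_l|].
  rewrite <- !comp_assoc, inv2_r, nat2_natural, comp_assoc, inv2_r.
  now rewrite comp_idl, comp_idr.
Qed.

Lemma nat2_tensl_natural (X X' Y Y' Z Z' : C)
    (f : hom X X') (g : hom Y Y') (h : hom Z Z') :
  (⌊D (X' ⊗ Y') Z'⌋ : End (X' ⊗ Y' ⊗ Z')) ∘ (f ⊗ₘ g ⊗ₘ h)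
  = (f ⊗ₘ g ⊗ₘ h) ∘ (⌊D (X ⊗ Y) Z⌋ : End (X ⊗ Y ⊗ Z)).
Proof.
  apply pack_inj.
  transitivity (pack (D (X' ⊗ Y') Z' ∘ ((f ⊗ₘ g) ⊗ₘ h))); [solve_pack|].
  rewrite nat2_natural; solve_pack.
Qed.

Lemma whiskerl_natural (X X' Y Y' Z Z' : C) (u : End (Y ⊗ Z)) (u' : End (Y' ⊗ Z'))
    (f : hom X X') (g : hom Y Y') (h : hom Z Z') :
  u' ∘ (g ⊗ₘ h) = (g ⊗ₘ h) ∘ u ->
  (idm X' ⊗ₘ u') ∘ (f ⊗ₘ g ⊗ₘ h) = (f ⊗ₘ g ⊗ₘ h) ∘ (idm X ⊗ₘ u).
Proof. intros e; now rewrite <- !tens_comp, e, comp_idl, comp_idr. Qed.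

Lemma whiskerl_inv2_l (X Y Z : C) :
  (idm X ⊗ₘ inv2 D Y Z) ∘ (idm X ⊗ₘ D Y Z) = idm (X ⊗ Y ⊗ Z).
Proof. now rewrite <- whisker_comp_l, inv2_l, tens_id. Qed.

Lemma whiskerl_inv2_r (X Y Z : C) :
  (idm X ⊗ₘ D Y Z) ∘ (idm X ⊗ₘ inv2 D Y Z) = idm (X ⊗ Y ⊗ Z).
Proof. now rewrite <- whisker_comp_l, inv2_r, tens_id. Qed.

Lemma whiskerr_inv2_l (X Y Z : C) :
  ⌊inv2 D X Y ⊗ₘ idm Z⌋ ∘ ⌊D X Y ⊗ₘ idm Z⌋ = idm (X ⊗ Y ⊗ Z).
Proof.
  now rewrite <- end_cast_comp, <- whisker_comp_r, inv2_l, tens_id, end_cast_id.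
Qed.

Lemma whiskerr_inv2_r (X Y Z : C) :
  ⌊D X Y ⊗ₘ idm Z⌋ ∘ ⌊inv2 D X Y ⊗ₘ idm Z⌋ = idm (X ⊗ Y ⊗ Z).
Proof.
  now rewrite <- end_cast_comp, <- whisker_comp_r, inv2_r, tens_id, end_cast_id.
Qed.

Lemma nat2_tensl_inv_l (X Y Z : C) :
  ⌊inv2 D (X ⊗ Y) Z⌋ ∘ ⌊D (X ⊗ Y) Z⌋ = idm (X ⊗ Y ⊗ Z).
Proof. now rewrite <- end_cast_comp, inv2_l, end_cast_id. Qed.

Lemma nat2_tensl_inv_r (X Y Z : C) :
  ⌊D (X ⊗ Y) Z⌋ ∘ ⌊inv2 D (X ⊗ Y) Z⌋ = idm (X ⊗ Y ⊗ Z).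
Proof. now rewrite <- end_cast_comp, inv2_r, end_cast_id. Qed.

Lemma nat2_whiskerl_comm (X Y Z : C) (u : End (Y ⊗ Z)) :
  D X (Y ⊗ Z) ∘ (idm X ⊗ₘ u) = (idm X ⊗ₘ u) ∘ D X (Y ⊗ Z).
Proof. apply nat2_natural. Qed.

Lemma nat2_whiskerr_comm (X Y Z : C) (u : End (X ⊗ Y)) :
  ⌊D (X ⊗ Y) Z⌋ ∘ ⌊u ⊗ₘ idm Z⌋
  = ⌊u ⊗ₘ idm Z⌋ ∘ ⌊D (X ⊗ Y) Z⌋ :> End (X ⊗ Y ⊗ Z).
Proof.
  transitivity (⌊D (X ⊗ Y) Z ∘ (u ⊗ₘ idm Z)⌋ : End (X ⊗ Y ⊗ Z)).
  - rewrite end_cast_comp; reflexivity.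
  - rewrite nat2_natural, end_cast_comp; reflexivity.
Qed.

(** The second twine axiom on its own: it has to be available before the third one is known when a
    twine is derived from the four-object identity. *)
Definition tens_compatible : Prop := forall X Y Z : C,
  ⌊D X Y ⊗ₘ idm Z⌋ ∘ ⌊D (X ⊗ Y) Z⌋ = (idm X ⊗ₘ D Y Z) ∘ D X (Y ⊗ Z)
  :> End (X ⊗ Y ⊗ Z).

(** * The automorphisms A and B built from D *)

Program Definition twineA : nat_auto3 C := {|
  nat3 X Y Z := ⌊D (X ⊗ Y) Z⌋ ∘ (idm X ⊗ₘ inv2 D Y Z);
  inv3 X Y Z := (idm X ⊗ₘ D Y Z) ∘ ⌊inv2 D (X ⊗ Y) Z⌋ |}.
Next Obligation.
  intros; cbv beta.
  rewrite comp_assoc, <- (comp_assoc _ _ _ _ _ _ _ (idm X ⊗ₘ inv2 D Y Z)).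
  now rewrite nat2_tensl_inv_l, comp_idl, whiskerl_inv2_r.
Qed.
Next Obligation.
  intros; cbv beta.
  rewrite comp_assoc, <- (comp_assoc _ _ _ _ _ (idm X ⊗ₘ inv2 D Y Z)).
  now rewrite whiskerl_inv2_l, comp_idl, nat2_tensl_inv_r.
Qed.
Next Obligation.
  intros; cbv beta.
  rewrite comp_assoc, (whiskerl_natural X X' Y Y' Z Z' (inv2 D Y Z)).
  - now rewrite <- !comp_assoc, nat2_tensl_natural.
  - apply inv2_natural.
Qed.

Program Definition twineB : nat_auto3 C := {|
  nat3 X Y Z := (idm X ⊗ₘ inv2 D Y Z) ∘ ⌊D (X ⊗ Y) Z⌋;
  inv3 X Y Z := ⌊inv2 D (X ⊗ Y) Z⌋ ∘ (idm X ⊗ₘ D Y Z) |}.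
Next Obligation.
  intros; cbv beta.
  rewrite comp_assoc, <- (comp_assoc _ _ _ _ _ (idm X ⊗ₘ D Y Z)).
  now rewrite whiskerl_inv2_r, comp_idl, nat2_tensl_inv_l.
Qed.
Next Obligation.
  intros; cbv beta.
  rewrite comp_assoc, <- (comp_assoc _ _ _ _ _ _ _ (idm X ⊗ₘ D Y Z)).
  now rewrite nat2_tensl_inv_r, comp_idl, whiskerl_inv2_l.
Qed.
Next Obligation.
  intros; cbv beta.
  rewrite comp_assoc, nat2_tensl_natural, <- !comp_assoc.
  rewrite (whiskerl_natural X X' Y Y' Z Z' (inv2 D Y Z)); [reflexivity|].
  apply inv2_natural.
Qed.

Lemma twineA_whiskerl (X Y Z : C) :
  ⌊D (X ⊗ Y) Z⌋ = twineA X Y Z ∘ (idm X ⊗ₘ D Y Z).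
Proof. cbn; now rewrite comp_assoc, whiskerl_inv2_l, comp_idr. Qed.

Lemma twineB_whiskerl (X Y Z : C) :
  ⌊D (X ⊗ Y) Z⌋ = (idm X ⊗ₘ D Y Z) ∘ twineB X Y Z.
Proof. cbn; now rewrite <- comp_assoc, whiskerl_inv2_r, comp_idl. Qed.

(** Compatibility replaces the right side by id ⊗ D_{Y,Z}, then D_{X,Y⊗Z}, then id ⊗ D_{Y,Z}^-1,
    read from the left. Naturality moves id ⊗ D_{Y,Z} past D_{X,Y⊗Z}, where it cancels its
    inverse. *)
Lemma twineA_whiskerr (X Y Z : C) : tens_compatible ->
  D X (Y ⊗ Z) = ⌊D X Y ⊗ₘ idm Z⌋ ∘ twineA X Y Z.
Proof.
  intros H; cbn; rewrite <- comp_assoc, H, <- nat2_whiskerl_comm.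
  now rewrite comp_assoc, whiskerl_inv2_r, comp_idr.
Qed.

Lemma twineB_whiskerr (X Y Z : C) : tens_compatible ->
  D X (Y ⊗ Z) = twineB X Y Z ∘ ⌊D X Y ⊗ₘ idm Z⌋.
Proof.
  intros H; cbn; rewrite comp_assoc, nat2_whiskerr_comm, H.
  now rewrite <- comp_assoc, whiskerl_inv2_l, comp_idl.
Qed.

Lemma twineA_alt (X Y Z : C) : tens_compatible ->
  twineA X Y Z = ⌊inv2 D X Y ⊗ₘ idm Z⌋ ∘ D X (Y ⊗ Z).
Proof.
  intros H; rewrite (twineA_whiskerr X Y Z H).
  now rewrite <- comp_assoc, whiskerr_inv2_l, comp_idl.
Qed.

Lemma twineB_alt (X Y Z : C) : tens_compatible ->
  twineB X Y Z = D X (Y ⊗ Z) ∘ ⌊inv2 D X Y ⊗ₘ idm Z⌋.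
Proof.
  intros H; rewrite (twineB_whiskerr X Y Z H).
  now rewrite comp_assoc, whiskerr_inv2_r, comp_idr.
Qed.

Lemma whisker3r_comp (X Y Z T : C) (f g : End (X ⊗ Y ⊗ Z)) :
  ⌊(f ∘ g) ⊗ₘ idm T⌋ = ⌊f ⊗ₘ idm T⌋ ∘ ⌊g ⊗ₘ idm T⌋
  :> End (X ⊗ Y ⊗ Z ⊗ T).
Proof. now rewrite whisker_comp_r, end_cast_comp. Qed.

Lemma middle_inv2_r (X Y Z T : C) :
  ⌊idm X ⊗ₘ D Y Z ⊗ₘ idm T⌋ ∘ ⌊idm X ⊗ₘ inv2 D Y Z ⊗ₘ idm T⌋
  = idm (X ⊗ Y ⊗ Z ⊗ T).
Proof.
  rewrite <- end_cast_comp, <- whisker_comp_l, <- whisker_comp_r, inv2_r.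
  now rewrite !tens_id, end_cast_id.
Qed.

(** * Commutation on four tensor factors *)

Section FourObjects.

Variables X Y Z T : C.
Variables (A : End (X ⊗ Y ⊗ Z)) (B : End (Y ⊗ Z ⊗ T)).
Hypothesis A_whiskerl : ⌊D (X ⊗ Y) Z⌋ = A ∘ (idm X ⊗ₘ D Y Z).
Hypothesis A_whiskerr : D X (Y ⊗ Z) = ⌊D X Y ⊗ₘ idm Z⌋ ∘ A.
Hypothesis B_whiskerl : ⌊D (Y ⊗ Z) T⌋ = (idm Y ⊗ₘ D Z T) ∘ B.
Hypothesis B_whiskerr : D Y (Z ⊗ T) = B ∘ ⌊D Y Z ⊗ₘ idm T⌋.

Local Notation W := (X ⊗ Y ⊗ Z ⊗ T).
(** [A] and [B] are known only through the four factorizations, so the results serve both a given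
    pure-braided structure and the one built from a twine. In these letters the remaining whiskered
    components of D become the words a r, p a, q b and b r. *)
Let a : End W := ⌊A ⊗ₘ idm T⌋.
Let b : End W := idm X ⊗ₘ B.
Let p : End W := ⌊D X Y ⊗ₘ idm Z ⊗ₘ idm T⌋.
Let q : End W := idm X ⊗ₘ idm Y ⊗ₘ D Z T.
Let r : End W := ⌊idm X ⊗ₘ D Y Z ⊗ₘ idm T⌋.

(** The two morphisms act on disjoint pairs of factors: this is interchange in (X ⊗ Y) ⊗ (Z ⊗ T). *)
Lemma four_outer_comm : p ∘ q = q ∘ p.
Proof.
  unfold p, q.
  transitivity (⌊(D X Y ⊗ₘ idm (Z ⊗ T)) ∘ (idm (X ⊗ Y) ⊗ₘ D Z T)⌋ : End W).
  - rewrite end_cast_comp; apply f_equal2; solve_cast.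
  - rewrite whisker_interchange, end_cast_comp; apply f_equal2; solve_cast.
Qed.

Lemma four_DXY_Z : (⌊D (X ⊗ Y) Z ⊗ₘ idm T⌋ : End W) = a ∘ r.
Proof.
  transitivity (⌊(⌊D (X ⊗ Y) Z⌋ : End (X ⊗ Y ⊗ Z)) ⊗ₘ idm T⌋ : End W);
    [solve_cast|].
  rewrite A_whiskerl, whisker3r_comp; unfold a, r.
  apply f_equal2; solve_cast.
Qed.

Lemma four_DX_YZ : (⌊D X (Y ⊗ Z) ⊗ₘ idm T⌋ : End W) = p ∘ a.
Proof.
  rewrite A_whiskerr, whisker3r_comp; unfold a, p.
  apply f_equal2; solve_cast.
Qed.

Lemma four_DYZ_T : (⌊idm X ⊗ₘ D (Y ⊗ Z) T⌋ : End W) = q ∘ b.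
Proof.
  transitivity (idm X ⊗ₘ (⌊D (Y ⊗ Z) T⌋ : End (Y ⊗ Z ⊗ T))); [solve_cast|].
  now rewrite B_whiskerl, whisker_comp_l.
Qed.

Lemma four_DY_ZT : (idm X ⊗ₘ D Y (Z ⊗ T) : End W) = b ∘ r.
Proof.
  rewrite B_whiskerr, whisker_comp_l; unfold b, r.
  apply f_equal2; solve_cast.
Qed.

(** The goal reads p q b a r = q p a b r, and p commutes with q. *)
Lemma four_object_of_comm : a ∘ b = b ∘ a ->
  p ∘ ⌊idm X ⊗ₘ D (Y ⊗ Z) T⌋ ∘ ⌊D (X ⊗ Y) Z ⊗ₘ idm T⌋
  = q ∘ ⌊D X (Y ⊗ Z) ⊗ₘ idm T⌋ ∘ (idm X ⊗ₘ D Y (Z ⊗ T)).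
Proof.
  intros ab; rewrite four_DYZ_T, four_DXY_Z, four_DX_YZ, four_DY_ZT.
  rewrite <- !comp_assoc, four_outer_comm, !(comp_assoc _ _ _ _ _ (q ∘ p)).
  now rewrite ab.
Qed.

(** In p q b a r = q p a b r, exchange p and q, then cancel r on the right and q, p on the left. *)
Lemma comm_of_four_object :
  p ∘ ⌊idm X ⊗ₘ D (Y ⊗ Z) T⌋ ∘ ⌊D (X ⊗ Y) Z ⊗ₘ idm T⌋
  = q ∘ ⌊D X (Y ⊗ Z) ⊗ₘ idm T⌋ ∘ (idm X ⊗ₘ D Y (Z ⊗ T)) ->
  a ∘ b = b ∘ a.
Proof.
  rewrite four_DYZ_T, four_DXY_Z, four_DX_YZ, four_DY_ZT; intros e.
  rewrite <- !comp_assoc, four_outer_comm in e.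
  apply comp_cancel_r with (v := ⌊idm X ⊗ₘ inv2 D Y Z ⊗ₘ idm T⌋) in e;
    [|apply middle_inv2_r].
  rewrite !(comp_assoc _ _ _ _ _ q), !(comp_assoc _ _ _ _ _ p) in e.
  apply comp_cancel_l with (v := idm X ⊗ₘ idm Y ⊗ₘ inv2 D Z T) in e;
    [|unfold q; now rewrite <- !whisker_comp_l, inv2_l, !tens_id].
  apply comp_cancel_l with (v := ⌊inv2 D X Y ⊗ₘ idm Z ⊗ₘ idm T⌋) in e.
  - now symmetry.
  - unfold p; rewrite <- end_cast_comp, !tens_id, <- whisker_comp_r, inv2_l.
    now rewrite tens_id, end_cast_id.
Qed.

(** The equation reads a r r^-1 b r = b r r^-1 a r, that is a b r = b a r, and r is invertible. *)
Lemma tw_comm_iff_comm :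
  (⌊D (X ⊗ Y) Z ⊗ₘ idm T⌋ ∘ ⌊idm X ⊗ₘ inv2 D Y Z ⊗ₘ idm T⌋
      ∘ (idm X ⊗ₘ D Y (Z ⊗ T))
    = (idm X ⊗ₘ D Y (Z ⊗ T)) ∘ ⌊idm X ⊗ₘ inv2 D Y Z ⊗ₘ idm T⌋
      ∘ ⌊D (X ⊗ Y) Z ⊗ₘ idm T⌋
    :> End (X ⊗ Y ⊗ Z ⊗ T))
  <-> a ∘ b = b ∘ a.
Proof.
  rewrite four_DXY_Z, four_DY_ZT, (comp_assoc _ _ _ _ _ a r).
  rewrite (comp_assoc _ _ _ _ _ b r); unfold r.
  rewrite middle_inv2_r, !comp_idr, <- !comp_assoc; fold r; split.
  - apply comp_cancel_r with (v := ⌊idm X ⊗ₘ inv2 D Y Z ⊗ₘ idm T⌋).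
    apply middle_inv2_r.
  - now intros ->.
Qed.

End FourObjects.

(** Taking the last object to be the unit in the four-object identity gives tensor compatibility.
    This supplies all the factorizations through [twineA] and [twineB], after which the last axiom
    and the full four-object identity express the same commutation. *)
Lemma twine_of_four_object :
  unital2 D -> four_object_identity D -> is_twine D.
Proof.
  intros U F.
  assert (H : tens_compatible).
  (* The four-object identity produces the right-hand factors in the opposite order; naturality
     reconciles the two. *)
  { intros X Y Z; rewrite <- nat2_whiskerl_comm.
    pose proof (F X Y Z unit_ob) as e; apply (f_equal pack) in e.
    assert (U1 : forall X, pack (D X unit_ob) = pack (idm X)).
    { intros V; rewrite <- (proj2 (U V)); solve_pack. }
    assert (l : (⌊idm X ⊗ₘ D (Y ⊗ Z) unit_ob⌋ : End (X ⊗ Y ⊗ Z ⊗ unit_ob))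
                = idm _).
    { apply pack_inj; rewrite pack_end_cast, pack_tens, U1; solve_pack. }
    assert (r : (idm X ⊗ₘ idm Y ⊗ₘ D Z unit_ob) = idm _).
    { apply pack_inj; rewrite !pack_tens, U1; solve_pack. }
    rewrite l, r, comp_idl, comp_idr in e.
    apply pack_inj; etransitivity; [|etransitivity; [exact e|]]; solve_pack. }
  split.
  - rewrite <- (proj1 (U unit_ob)); solve_cast.
  - exact H.
  - intros X Y Z T.
    apply tw_comm_iff_comm with (A := twineA X Y Z) (B := twineB Y Z T).
    + apply twineA_whiskerl.
    + now apply twineB_whiskerr.
    + apply comm_of_four_object; auto using twineA_whiskerl, twineA_whiskerr,
        twineB_whiskerl, twineB_whiskerr.
Qed.

(** Since D_{I,I} is the identity, tensor compatibility at (I, I, X) and at (X, I, I) says that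
    D_{I,X} and D_{X,I} are idempotent; being invertible, they are identities. *)
Lemma twine_unital : is_twine D -> unital2 D.
Proof.
  intros [D1 H _].
  assert (p1 : pack (D unit_ob unit_ob) = pack (idm unit_ob)).
  { rewrite <- D1; solve_pack. }
  intros X; split.
  - apply comp_idem_id with (v := ⌊inv2 D unit_ob X⌋).
    { now rewrite <- end_cast_comp, inv2_l, end_cast_id. }
    pose proof (H unit_ob unit_ob X) as e.
    replace (⌊D unit_ob unit_ob ⊗ₘ idm X⌋ : End (unit_ob ⊗ unit_ob ⊗ X))
      with (idm (unit_ob ⊗ unit_ob ⊗ X)) in e.
    2:{ apply pack_inj; rewrite pack_end_cast, pack_tens, p1; solve_pack. }
    rewrite comp_idl in e; apply (f_equal pack) in e; symmetry in e.
    apply pack_inj; etransitivity; [|etransitivity; [exact e|]]; solve_pack.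
  - apply comp_idem_id with (v := ⌊inv2 D X unit_ob⌋).
    { now rewrite <- end_cast_comp, inv2_l, end_cast_id. }
    pose proof (H X unit_ob unit_ob) as e.
    replace (idm X ⊗ₘ D unit_ob unit_ob)
      with (idm (X ⊗ unit_ob ⊗ unit_ob)) in e.
    2:{ apply pack_inj; rewrite pack_tens, p1; solve_pack. }
    rewrite comp_idl in e; apply (f_equal pack) in e.
    apply pack_inj; etransitivity; [|etransitivity; [exact e|]]; solve_pack.
Qed.

Lemma pure_braided_of_twine : is_twine D -> is_pure_braided twineA twineB.
Proof.
  intros TW; pose proof (tw_tens _ TW : tens_compatible) as H.
  split; [intros U V W X .. | intros U V].
  (* After composing on the right with id ⊗ id ⊗ D_{W,X}, both sides equal D_{U⊗V⊗W,X}. *)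
  - apply comp_cancel_r with (u := idm U ⊗ₘ idm V ⊗ₘ D W X)
      (v := idm U ⊗ₘ idm V ⊗ₘ inv2 D W X).
    { now rewrite <- !whisker_comp_l, inv2_r, !tens_id. }
    rewrite comp_assoc, <- whisker_comp_l, <- twineA_whiskerl.
    transitivity (⌊D (U ⊗ V ⊗ W) X⌋ : End (U ⊗ V ⊗ W ⊗ X)).
    + transitivity (⌊twineA (U ⊗ V) W X ∘ (idm (U ⊗ V) ⊗ₘ D W X)⌋
                    : End (U ⊗ V ⊗ W ⊗ X)).
      * rewrite end_cast_comp; apply f_equal2; solve_cast.
      * rewrite <- twineA_whiskerl; solve_cast.
    + transitivity (⌊twineA U (V ⊗ W) X ∘ (idm U ⊗ₘ D (V ⊗ W) X)⌋
                    : End (U ⊗ V ⊗ W ⊗ X)).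
      * rewrite <- twineA_whiskerl; solve_cast.
      * rewrite end_cast_comp; apply f_equal2; solve_cast.
  (* After composing on the left with D_{U,V} ⊗ id, both sides equal D_{U,V⊗W⊗X}. *)
  - apply comp_cancel_l with (u := ⌊D U V ⊗ₘ idm (W ⊗ X)⌋)
      (v := ⌊inv2 D U V ⊗ₘ idm (W ⊗ X)⌋).
    { apply whiskerr_inv2_l. }
    rewrite <- twineA_whiskerr, <- comp_assoc by assumption.
    replace (⌊D U V ⊗ₘ idm (W ⊗ X)⌋ : End (U ⊗ V ⊗ W ⊗ X))
      with (⌊(⌊D U V ⊗ₘ idm W⌋ : End (U ⊗ V ⊗ W)) ⊗ₘ idm X⌋
            : End (U ⊗ V ⊗ W ⊗ X)) by solve_cast.
    rewrite <- whisker3r_comp, <- twineA_whiskerr by assumption.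
    transitivity (⌊D U ((V ⊗ W) ⊗ X)⌋ : End (U ⊗ V ⊗ W ⊗ X)); [solve_cast|].
    rewrite (twineA_whiskerr U (V ⊗ W) X H), end_cast_comp.
    apply f_equal2; solve_cast.
  (* The axioms for B follow in the same way, with the auxiliary factor on the opposite side. *)
  - apply comp_cancel_l with (u := idm U ⊗ₘ idm V ⊗ₘ D W X)
      (v := idm U ⊗ₘ idm V ⊗ₘ inv2 D W X).
    { now rewrite <- !whisker_comp_l, inv2_l, !tens_id. }
    rewrite <- comp_assoc, <- whisker_comp_l, <- twineB_whiskerl.
    transitivity (⌊D (U ⊗ V ⊗ W) X⌋ : End (U ⊗ V ⊗ W ⊗ X)).
    + transitivity (⌊(idm (U ⊗ V) ⊗ₘ D W X) ∘ twineB (U ⊗ V) W X⌋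
                    : End (U ⊗ V ⊗ W ⊗ X)).
      * rewrite end_cast_comp; apply f_equal2; solve_cast.
      * rewrite <- twineB_whiskerl; solve_cast.
    + transitivity (⌊(idm U ⊗ₘ D (V ⊗ W) X) ∘ twineB U (V ⊗ W) X⌋
                    : End (U ⊗ V ⊗ W ⊗ X)).
      * rewrite <- twineB_whiskerl; solve_cast.
      * rewrite end_cast_comp; apply f_equal2; solve_cast.
  - apply comp_cancel_r with (u := ⌊D U V ⊗ₘ idm (W ⊗ X)⌋)
      (v := ⌊inv2 D U V ⊗ₘ idm (W ⊗ X)⌋).
    { apply whiskerr_inv2_r. }
    rewrite <- twineB_whiskerr, comp_assoc by assumption.
    replace (⌊D U V ⊗ₘ idm (W ⊗ X)⌋ : End (U ⊗ V ⊗ W ⊗ X))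
      with (⌊(⌊D U V ⊗ₘ idm W⌋ : End (U ⊗ V ⊗ W)) ⊗ₘ idm X⌋
            : End (U ⊗ V ⊗ W ⊗ X)) by solve_cast.
    rewrite <- whisker3r_comp, <- twineB_whiskerr by assumption.
    transitivity (⌊D U ((V ⊗ W) ⊗ X)⌋ : End (U ⊗ V ⊗ W ⊗ X)); [solve_cast|].
    rewrite (twineB_whiskerr U (V ⊗ W) X H), end_cast_comp.
    apply f_equal2; solve_cast.
  - eapply tw_comm_iff_comm.
    + apply twineA_whiskerl.
    + now apply twineB_whiskerr.
    + apply (tw_comm _ TW).
  (* With D_{I,V} trivial, A and B at (U, I, V) both reduce to D_{U⊗I,V}. *)
  - assert (i : idm U ⊗ₘ inv2 D unit_ob V = idm (U ⊗ unit_ob ⊗ V)).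
    { assert (d : D unit_ob V = idm (unit_ob ⊗ V)).
      { apply pack_inj; transitivity (pack (⌊D unit_ob V⌋ : End V)).
        - solve_pack.
        - rewrite (proj1 (twine_unital TW V)); solve_pack. }
      now rewrite <- (comp_idr _ _ _ (inv2 D unit_ob V)), <- d, inv2_l, tens_id. }
    cbn; now rewrite i, comp_idl, comp_idr.
Qed.

End NaturalAutomorphism.

(** * From a pure-braided structure to D, with the unit as middle object *)

Section UnitComponent.

Variable C : strict_monoidal_category.
Variables A B : nat_auto3 C.
Hypothesis AB : is_pure_braided A B.

Program Definition unit_component : nat_auto2 C := {|
  nat2 U V := ⌊A U unit_ob V⌋;
  inv2 U V := ⌊inv3 A U unit_ob V⌋ |}.
Next Obligation. intros; cbv beta; now rewrite <- end_cast_comp, inv3_l, end_cast_id. Qed.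
Next Obligation. intros; cbv beta; now rewrite <- end_cast_comp, inv3_r, end_cast_id. Qed.
Next Obligation.
  intros; cbv beta.
  apply pack_inj.
  (* Naturality of A is applied with the identity of the unit in the middle slot. *)
  transitivity (pack (A X' unit_ob Y' ∘ (f ⊗ₘ idm unit_ob ⊗ₘ g))); [solve_pack|].
  rewrite nat3_natural; solve_pack.
Qed.

Local Notation D := unit_component.

Lemma unit_component_A (U V : C) : pack (D U V) = pack (A U unit_ob V).
Proof. cbn; solve_pack. Qed.

Lemma unit_component_B (U V : C) : pack (D U V) = pack (B U unit_ob V).
Proof. now rewrite unit_component_A, (pb_unit _ _ AB). Qed.

(** First axiom for A with its third object W equal to the unit. The three companion factorizations
    likewise put the unit at W (left tensor axioms) or at V (right tensor axioms). *)
Lemma unit_component_A_whiskerl (X Y Z : C) :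
  ⌊D (X ⊗ Y) Z⌋ = A X Y Z ∘ (idm X ⊗ₘ D Y Z).
Proof.
  pose proof (f_equal pack (pb_A_tensl _ _ AB X Y unit_ob Z)) as e.
  rewrite pack_end_cast in e.
  apply pack_inj; rewrite pack_end_cast, unit_component_A, e.
  apply pack_comp_congr; [solve_pack|].
  now rewrite !pack_tens, unit_component_A.
Qed.

Lemma unit_component_A_whiskerr (X Y Z : C) :
  D X (Y ⊗ Z) = ⌊D X Y ⊗ₘ idm Z⌋ ∘ A X Y Z.
Proof.
  pose proof (f_equal pack (pb_A_tensr _ _ AB X unit_ob Y Z)) as e.
  apply pack_inj; rewrite unit_component_A, e.
  apply pack_comp_congr; [|solve_pack].
  rewrite !pack_end_cast, !pack_tens, unit_component_A; reflexivity.
Qed.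

Lemma unit_component_B_whiskerl (X Y Z : C) :
  ⌊D (X ⊗ Y) Z⌋ = (idm X ⊗ₘ D Y Z) ∘ B X Y Z.
Proof.
  pose proof (f_equal pack (pb_B_tensl _ _ AB X Y unit_ob Z)) as e.
  rewrite pack_end_cast in e.
  apply pack_inj; rewrite pack_end_cast, unit_component_B, e.
  apply pack_comp_congr; [|solve_pack].
  now rewrite !pack_tens, unit_component_B.
Qed.

Lemma unit_component_B_whiskerr (X Y Z : C) :
  D X (Y ⊗ Z) = B X Y Z ∘ ⌊D X Y ⊗ₘ idm Z⌋.
Proof.
  pose proof (f_equal pack (pb_B_tensr _ _ AB X unit_ob Y Z)) as e.
  apply pack_inj; rewrite unit_component_B, e.
  apply pack_comp_congr; [solve_pack|].
  rewrite !pack_end_cast, !pack_tens, unit_component_B; reflexivity.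
Qed.

(** The factorizations of A at (I, I, X) and (X, I, I) turn A itself into D, so D_{I,X} and D_{X,I}
    are invertible idempotents. *)
Lemma unit_component_unital : unital2 D.
Proof.
  intros X; split.
  - apply comp_idem_id with (v := ⌊inv2 D unit_ob X⌋).
    { now rewrite <- end_cast_comp, inv2_l, end_cast_id. }
    pose proof (f_equal pack (unit_component_A_whiskerl unit_ob unit_ob X)) as e.
    symmetry in e; apply pack_inj; etransitivity; [|etransitivity; [exact e|]].
    + apply pack_comp_congr; [rewrite <- unit_component_A|]; solve_pack.
    + solve_pack.
  - apply comp_idem_id with (v := ⌊inv2 D X unit_ob⌋).
    { now rewrite <- end_cast_comp, inv2_l, end_cast_id. }
    pose proof (f_equal pack (unit_component_A_whiskerr X unit_ob unit_ob)) as e.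
    symmetry in e; apply pack_inj; etransitivity; [|etransitivity; [exact e|]].
    + apply pack_comp_congr; [|rewrite <- unit_component_A]; solve_pack.
    + solve_pack.
Qed.

(** The four factorizations reduce the identity to the commutation of A ⊗ id with id ⊗ B, which is
    the fifth pure-braided axiom. *)
Lemma unit_component_four_object : four_object_identity D.
Proof.
  intros X Y Z T; apply four_object_of_comm with (A := A X Y Z) (B := B Y Z T).
  - apply unit_component_A_whiskerl.
  - apply unit_component_A_whiskerr.
  - apply unit_component_B_whiskerl.
  - apply unit_component_B_whiskerr.
  - apply (pb_comm _ _ AB).
Qed.

End UnitComponent.

Theorem proposition2p6 (C : strict_monoidal_category) :
  (forall A B : nat_auto3 C, is_pure_braided A B ->
    exists D : nat_auto2 C,
      (forall U V : C, D U V = ⌊A U unit_ob V⌋ /\ D U V = ⌊B U unit_ob V⌋)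
      /\ unital2 D /\ four_object_identity D)
  /\
  (forall D : nat_auto2 C, unital2 D -> four_object_identity D -> is_twine D)
  /\
  (forall D : nat_auto2 C, is_twine D ->
    exists A B : nat_auto3 C,
      (forall X Y Z : C,
        A X Y Z = ⌊D (X ⊗ Y) Z⌋ ∘ (idm X ⊗ₘ inv2 D Y Z)
        /\ A X Y Z = ⌊inv2 D X Y ⊗ₘ idm Z⌋ ∘ D X (Y ⊗ Z))
      /\ (forall X Y Z : C,
        B X Y Z = (idm X ⊗ₘ inv2 D Y Z) ∘ ⌊D (X ⊗ Y) Z⌋
        /\ B X Y Z = D X (Y ⊗ Z) ∘ ⌊inv2 D X Y ⊗ₘ idm Z⌋)
      /\ is_pure_braided A B).
Proof.
  split; [|split].
  - intros A B AB; exists (unit_component C A); split; [|split].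
    + intros U V; split; [reflexivity|].
      cbn; now rewrite (pb_unit _ _ AB).
    + now apply unit_component_unital with (B := B).
    + now apply unit_component_four_object with (B := B).
  - apply twine_of_four_object.
  - intros D TW; exists (twineA C D), (twineB C D); split; [|split].
    + intros X Y Z; split; [reflexivity|].
      apply twineA_alt; exact (tw_tens _ TW).
    + intros X Y Z; split; [reflexivity|].
      apply twineB_alt; exact (tw_tens _ TW).
    + now apply pure_braided_of_twine.
Qed.
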